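(* For any $K_k$-minor-free (simple) graph $G$ of maximum degree $\Delta$, the strong clique number of $G$ satisfies $\omega_2'(G)\le (k-1)(\Delta+1)$.
   Context: A strong clique of a graph $G$ is a set of edges every two of which share an endpoint or are joined by an edge of $G$ (an edge having one endpoint in common with each of them). The strong clique number $\omega_2'(G)$ is the maximum size of a strong clique; equivalently, the clique number of the square of the line graph of $G$. *)

(* Defs.v *)
From mathcomp Require Import all_boot.
Set Implicit Arguments.
Unset Strict Implicit.
Unset Printing Implicit Defensive.

Record sgraph := SGraph {
  vertex :> finType;
  adj : rel vertex;
  adj_sym : symmetric adj;
  adj_irrefl : irreflexive adj }.

Definition complete_adj (k : nat) : rel 'I_k := fun i j => i != j.

Lemma complete_adj_sym k : symmetric (@complete_adj k).
Proof. by move=> i j; rewrite /complete_adj eq_sym. Qed.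

Lemma complete_adj_irrefl k : irreflexive (@complete_adj k).
Proof. by move=> i; rewrite /complete_adj eqxx. Qed.

Definition complete_graph (k : nat) : sgraph :=
  SGraph (@complete_adj_sym k) (@complete_adj_irrefl k).

Definition degree (G : sgraph) (x : G) : nat := #|[set y | adj x y]|.

Definition max_degree (G : sgraph) : nat := \max_(x : G) degree x.

(* Paths are confined to B: this is connectedness of the subgraph induced on
   B, which is required to be nonempty. *)
Definition connected_set (G : sgraph) (B : {set G}) : Prop :=
  B != set0 /\
  {in B &, forall x y : G,
    connect [rel u v | [&& u \in B, v \in B & adj u v]] x y}.

(* H is a minor of G, via branch sets: contracting each phi i to a vertex and
   deleting the superfluous vertices and edges of G yields H. *)
Definition minor (H G : sgraph) : Prop :=
  exists phi : H -> {set G},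
    [/\ forall i, connected_set (phi i),
        forall i j, i != j -> [disjoint phi i & phi j]
      & forall i j, adj i j -> exists x y, [/\ x \in phi i, y \in phi j & adj x y]].

Definition minor_free (H G : sgraph) : Prop := ~ minor H G.

Definition edges (G : sgraph) : {set {set G}} :=
  [set [set p.1; p.2] | p : G * G & adj p.1 p.2].

Definition share_endpoint (G : sgraph) (e f : {set G}) : bool :=
  [exists x, (x \in e) && (x \in f)].

Definition joined_by_edge (G : sgraph) (e f : {set G}) : bool :=
  [exists x in e, exists y in f, adj x y].

Definition strong_clique (G : sgraph) (S : {set {set G}}) : bool :=
  (S \subset edges G) &&
  [forall e in S, forall f in S,
    (e != f) ==> share_endpoint e f || joined_by_edge e f].

Definition strong_clique_number (G : sgraph) : nat :=
  \max_(S : {set {set G}} | strong_clique S) #|S|.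

(* Main.v *)
(** If no two edges of a matching [M] inside a strong clique share an endpoint,
    they are all joined by edges, so the edges of [M] are the branch sets of a
    [K_#|M|] minor.  A strong clique is thus a set of edges with all degrees at
    most [Delta] and all matchings of size at most [k - 1], and it remains to
    see that a graph of maximum degree [d] and matching number [n] has at most
    [n * (d + 1)] edges.  This follows from Vizing's theorem, but Gallai's lemma
    is enough: deleting a vertex covered by all maximum matchings decreases [n]
    and loses at most [d] edges; if there is no such vertex, then "no maximum
    matching misses both [u] and [v]" is an equivalence relation containing
    adjacency, a maximum matching misses at most one vertex of each class, and
    one counts the edges class by class. *)
Require Import Defs.
From mathcomp Require Import all_boot.

Set Implicit Arguments.
Unset Strict Implicit.
Unset Printing Implicit Defensive.

(** * Bounding the number of edges by matching number and maximum degree *)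

Section MatchingNumber.

Variable T : finType.
Implicit Types (S M N : {set {set T}}) (e f : {set T}) (u v x y : T).

Definition edge_degree S x := #|[set e in S | x \in e]|.

Definition matching_of_size S n : pred {set {set T}} :=
  [pred M : {set {set T}} | [&& M \subset S, trivIset M & #|M| == n]].

Lemma coverP M x : reflect (exists2 e, e \in M & x \in e) (x \in cover M).
Proof. exact: bigcupP. Qed.

Lemma disjoint_setP (A B : {set T}) :
  reflect (forall x, x \in A -> x \in B -> False) [disjoint A & B].
Proof.
apply: (iffP idP) => [dis x xA | dis]; first by rewrite (disjointFr dis xA).
rewrite -setI_eq0; apply/eqP/setP => x; rewrite !inE.
by apply/negP => /andP[]; exact: dis.
Qed.

Lemma trivIset_eq M e f x :
  trivIset M -> e \in M -> f \in M -> x \in e -> x \in f -> e = f.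
Proof.
move=> tM eM fM xe xf; apply/eqP/negPn/negP => nef.
have /disjoint_setP dis := trivIsetP tM e f eM fM nef.
exact: (dis x xe xf).
Qed.

Lemma trivIset_add M e :
  trivIset M -> (forall x, x \in e -> x \notin cover M) -> trivIset (e |: M).
Proof.
move=> tM eM; apply/trivIsetP => a b.
have dis c : c \in M -> [disjoint e & c].
  move=> cM; apply/disjoint_setP => x xe xc.
  by move/negP: (eM x xe); apply; apply/coverP; exists c.
rewrite !inE => /orP[/eqP-> | aM] /orP[/eqP-> | bM]; rewrite ?eqxx //.
- by move=> _; exact: dis.
- by move=> _; rewrite disjoint_sym; exact: dis.
- exact: (trivIsetP tM).
Qed.

Lemma sum_edge_degree S :
  (forall e, e \in S -> #|e| = 2) -> \sum_x edge_degree S x = 2 * #|S|.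
Proof.
move=> S2; rewrite mulnC -sum_nat_const.
rewrite (eq_bigr (fun x => \sum_(e in S) (x \in e : nat))); last first.
  move=> x _; rewrite /edge_degree -sum1_card big_mkcond [RHS]big_mkcond /=.
  by apply: eq_bigr => e _; rewrite inE; case: (e \in S); case: (x \in e).
rewrite exchange_big; apply: eq_bigr => e eS.
by rewrite -(S2 e eS) -sum1_card [RHS]big_mkcond /=; apply: eq_bigr => x _; case: (x \in e).
Qed.

Lemma card_cover_matching S n M :
  (forall e, e \in S -> #|e| = 2) -> matching_of_size S n M ->
  #|cover M| = 2 * n.
Proof.
move=> S2 /and3P[/subsetP MS /eqP tM /eqP <-].
rewrite -tM mulnC -sum_nat_const; apply: eq_bigr => e eM.
exact/S2/MS.
Qed.

Section Gallai.

Variables (S : {set {set T}}) (n : nat).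
Hypothesis S2 : forall e, e \in S -> #|e| = 2.
Hypothesis matching_le : forall M, M \subset S -> trivIset M -> #|M| <= n.
Hypothesis missable :
  forall x, exists2 M, matching_of_size S n M & x \notin cover M.

(** Otherwise [e] could be added to [M], giving a matching of size [n + 1]. *)
Lemma maximum_matching_meets M e :
  matching_of_size S n M -> e \in S -> exists2 y, y \in e & y \in cover M.
Proof.
move=> /and3P[MS tM /eqP cM] eS.
suff: [exists y in e, y \in cover M] by case/exists_inP=> y; exists y.
case: exists_inP => // neM; have eM x : x \in e -> x \notin cover M.
  by move=> xe; apply/negP => xM; case: neM; exists x.
have [x xe] : exists x, x \in e by apply/card_gt0P; rewrite S2.
have eNM : e \notin M.
  by apply/negP => eM'; move/negP: (eM x xe); apply; apply/coverP; exists e.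
have eMS : e |: M \subset S by rewrite subUset sub1set eS.
by have := matching_le eMS (trivIset_add tM eM); rewrite cardsU1 eNM cM add1n ltnn.
Qed.

(** The disjunct [u == v] supplies reflexivity: by [missable] some maximum matching misses [u], so
    the second disjunct fails at [v = u]. *)
Definition gallai_rel u v :=
  (u == v) ||
  [forall M, matching_of_size S n M ==> (u \in cover M) || (v \in cover M)].

Lemma gallai_refl : reflexive gallai_rel.
Proof. by move=> x; rewrite /gallai_rel eqxx. Qed.

Lemma gallai_sym : symmetric gallai_rel.
Proof.
move=> u v; rewrite /gallai_rel eq_sym; congr orb.
by apply: eq_forallb => M; rewrite orbC.
Qed.

Lemma gallai_covers u v M :
  gallai_rel u v -> u != v -> matching_of_size S n M ->
  u \notin cover M -> v \in cover M.
Proof.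
case/orP=> [/eqP-> | /forallP/(_ M)/implyP H]; first by rewrite eqxx.
by move=> _ mM /negPf uM; have := H mM; rewrite uM.
Qed.

(* If [M] misses [u] and [v], take [N] missing [t] with as large an overlap with
   [M] as possible; [N] covers [u] and [v], so by counting [M] covers a vertex
   [x != t] that [N] misses, and swapping in the edge of [M] at [x] increases
   the overlap. *)
Lemma gallai_trans : transitive gallai_rel.
Proof.
move=> t u v Rut Rtv.
have [->|nut] := eqVneq u t; first by [].
have [<-|ntv] := eqVneq t v; first by [].
have [->|nuv] := eqVneq u v; first exact: gallai_refl.
apply/orP; right; apply/forallP => M; apply/implyP => mM.
apply/negPn/negP; rewrite negb_or => /andP[uM vM].
pose P N := matching_of_size S n N && (t \notin cover N).
have [N0 mN0 tN0] := missable t.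
have PN0 : P N0 by rewrite /P mN0.
case: (arg_maxnP (fun N => #|M :&: N|) PN0) => N /andP[mN tN] maxN.
have uN : u \in cover N by apply: (gallai_covers _ _ mN tN); rewrite 1?gallai_sym 1?eq_sym.
have vN : v \in cover N by exact: (gallai_covers Rtv).
have cardD : #|cover M :\: cover N| = #|cover N :\: cover M|.
  apply/eqP; rewrite -(eqn_add2l #|cover M :&: cover N|) cardsID.
  by rewrite setIC cardsID !(card_cover_matching S2 (n := n)).
have : 1 < #|cover M :\: cover N|.
  have <- : #|[set u; v]| = 2 by rewrite cards2 nuv.
  rewrite cardD; apply/subset_leq_card/subsetP => z.
  by rewrite !inE => /orP[] /eqP->; rewrite ?uM ?vM.
rewrite (cardsD1 t) => lt1.
have /card_gt0P[x] : 0 < #|(cover M :\: cover N) :\ t|.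
  by move: lt1; case: (t \in _); case: #|_|.
rewrite !inE => /and3P[nxt xN /coverP[e eM xe]].
case/and3P: (mM) => /subsetP MS tM _; case/and3P: (mN) => NS tNN /eqP cN.
have eS := MS e eM.
(* By maximality [N] covers the other endpoint [y] of [e], through an edge [f] to be exchanged for
   [e]. Since [f] meets [e] at [y], it is not in [M], so the exchange loses nothing of [M :&: N]. *)
have [y ye yN] := maximum_matching_meets mN eS.
have /coverP[f fN yf] := yN.
have nxy : x != y by apply: contraNneq xN => ->.
have eE z : z \in e -> z = x \/ z = y.
  have : [set x; y] == e.
    by rewrite eqEcard subUset !sub1set xe ye S2 // cards2 nxy.
  by move/eqP<-; rewrite !inE => /orP[] /eqP; [left | right].
have eN : e \notin N by apply: contra xN => eN; apply/coverP; exists e.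
have fM : f \notin M.
  apply/negP => fM; move: eN.
  by rewrite (trivIset_eq tM eM fM ye yf) fN.
have sub_cover z : z \in cover (N :\ f) -> z \in cover N.
  by case/coverP=> g /setD1P[_ gN] zg; apply/coverP; exists g.
have PN' : P (e |: (N :\ f)).
  apply/andP; split.
    apply/and3P; split.
    - rewrite subUset sub1set eS; exact: subset_trans (subD1set _ _) NS.
    - apply: trivIset_add; first exact: trivIsetS (subD1set _ _) tNN.
      move=> z /eE[]->; first by apply: contra xN; exact: sub_cover.
      apply/negP => /coverP[g /setD1P[ngf gN] yg].
      by move/eqP: ngf; apply; exact: (trivIset_eq tNN gN fN yg yf).
    - by rewrite cardsU1 !inE (negPf eN) andbF -cN (cardsD1 f N) fN.
  apply/negP => /coverP[g]; rewrite !inE => /orP[/eqP-> | /andP[_ gN]] tg.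
    have [tx | ty] := eE t tg; first by rewrite tx eqxx in nxt.
    by rewrite ty yN in tN.
  by move/negP: tN; apply; apply/coverP; exists g.
have := maxN _ PN'; apply/negP; rewrite -ltnNge.
apply: proper_card; apply/properP; split.
  apply/subsetP => g; rewrite !inE => /andP[gM gN]; rewrite gM gN andbT /=.
  by apply/orP; right; apply: contraNneq fM => <-.
by exists e; rewrite !inE ?eM ?eqxx // (negPf eN).
Qed.

Lemma edge_gallai_rel e x y : e \in S -> x \in e -> y \in e -> gallai_rel x y.
Proof.
move=> eS xe ye; have [->|nxy] := eqVneq x y; first exact: gallai_refl.
apply/orP; right; apply/forallP => M; apply/implyP => mM.
have [z ze zM] := maximum_matching_meets mM eS.
have : [set x; y] == e.
  by rewrite eqEcard subUset !sub1set xe ye S2 // cards2 nxy.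
move/eqP => eE; move: ze; rewrite -eE !inE.
by case/orP=> /eqP <-; rewrite zM ?orbT.
Qed.

Definition gallai_class x := [set y | gallai_rel x y].

Lemma gallai_class_eq x y : (gallai_class y == gallai_class x) = (y \in gallai_class x).
Proof.
apply/eqP/idP => [<- | ]; first by rewrite inE gallai_refl.
rewrite inE => Rxy; apply/setP => z; rewrite !inE.
apply/idP/idP; first exact: gallai_trans.
by apply: gallai_trans; rewrite gallai_sym.
Qed.

(** All neighbours of [x] along [S] lie in its class, and so does [x] itself, whence the strict
    inequality. *)
Lemma edge_degree_lt_class x : edge_degree S x < #|gallai_class x|.
Proof.
have xC : x \in gallai_class x by rewrite inE gallai_refl.
rewrite (cardsD1 x) xC add1n ltnS.
apply: leq_trans (leq_imset_card (fun y => [set x; y]) _).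
apply/subset_leq_card/subsetP => e; rewrite inE => /andP[eS xe].
have : 0 < #|e :\ x| by have := S2 eS; rewrite (cardsD1 x) xe; case: #|_|.
case/card_gt0P => y /setD1P[nyx ye].
apply/imsetP; exists y.
  by rewrite !inE nyx (edge_gallai_rel eS).
apply/esym/eqP.
by rewrite eqEcard subUset !sub1set xe ye S2 // cards2 eq_sym nyx.
Qed.

Lemma class_card_le M x :
  matching_of_size S n M ->
  #|gallai_class x| <= #|gallai_class x :&: cover M|.+1.
Proof.
move=> mM; rewrite -(cardsID (cover M) (gallai_class x)) -addn1 leq_add2l.
apply/card_le1_eqP => y z; rewrite !inE => /andP[yM Rxy] /andP[zM Rxz].
apply/eqP/negPn/negP; rewrite eq_sym => nyz; move/negP: zM; apply.
apply: (gallai_covers _ nyz mM yM).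
by apply: gallai_trans Rxz; rewrite gallai_sym.
Qed.

Lemma card_le_missable d :
  (forall x, edge_degree S x <= d) -> #|S| <= n * d.+1.
Proof.
move=> degS.
have [->|[e0 e0S]] := set_0Vmem S; first by rewrite cards0.
have [x0 _] : exists x, x \in e0 by apply/card_gt0P; rewrite S2.
have [M mM _] := missable x0.
(* After doubling, the left side is the degree sum and the right side sums [d + 1] over the [2 * n]
   vertices covered by [M]. *)
rewrite -(leq_pmul2l (m := 2)) // mulnA -(card_cover_matching S2 mM).
rewrite -sum_edge_degree // -sum_nat_const.
rewrite (partition_big gallai_class predT) // [leqRHS](partition_big gallai_class predT) //=.
apply: leq_sum => C _.
(* [C] ranges over all vertex sets; if it is not a class, its left-hand sum is empty. *)
case: (pickP (fun x => gallai_class x == C)) => [x /eqP <-{C} | C0]; last first.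
  by rewrite big_pred0.
rewrite (eq_bigl (mem (gallai_class x))); last by move=> y; exact: gallai_class_eq.
rewrite [leqRHS](eq_bigl (mem (gallai_class x :&: cover M))); last first.
  by move=> y; rewrite gallai_class_eq !inE andbC.
rewrite sum_nat_const.
have := class_card_le x mM; set m := #|_ :&: _| => cm.
(* A class with [m] covered vertices has at most [m + 1] vertices, of degree at most [minn m d]
   each, and [(m + 1) * minn m d <= m * (d + 1)]. *)
have degm y : y \in gallai_class x -> edge_degree S y <= minn m d.
  rewrite leq_min degS andbT -gallai_class_eq => /eqP Cy.
  by rewrite -ltnS; apply: leq_trans cm; rewrite -Cy edge_degree_lt_class.
apply: (leq_trans (leq_sum _ degm)).
rewrite sum_nat_const; apply: (leq_trans (leq_mul cm (leqnn _))).
have [md|dm] := leqP m d; first by rewrite mulnC leq_mul.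
by rewrite mulSn mulnS leq_add2r ltnW.
Qed.

End Gallai.

Lemma card_le_matching_degree S n d :
  (forall e, e \in S -> #|e| = 2) ->
  (forall M, M \subset S -> trivIset M -> #|M| <= n) ->
  (forall x, edge_degree S x <= d) ->
  #|S| <= n * d.+1.
Proof.
elim: n S => [|n IHn] S S2 matS degS.
  (* For [n = 0] the empty matching is maximum and misses every vertex. *)
  apply: card_le_missable => // x; exists set0; last by rewrite /cover big_set0 inE.
  apply/and3P; split; rewrite ?sub0set ?cards0 //.
  by apply/trivIsetP => A B; rewrite inE.
(* Here [n.+1] is only an upper bound: if no matching attains it, every vertex passes the test
   vacuously and may be deleted. *)
case: (pickP (fun v => [forall M, matching_of_size S n.+1 M ==> (v \in cover M)])).
  move=> v /forallP allv.
  pose S' := [set e in S | v \notin e].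
  have S'S : S' \subset S by apply/subsetP => e; rewrite inE => /andP[].
  have SE : #|S| = edge_degree S v + #|S'|.
    rewrite -(cardsID [set e : {set T} | v \in e]); congr (_ + _); apply: eq_card => e.
      by rewrite !inE.
    by rewrite !inE andbC.
  rewrite SE mulSn; apply: leq_add; first exact: leqW.
  apply: IHn.
  - by move=> e /(subsetP S'S); exact: S2.
  (* A matching of size [n.+1] in [S'] would be maximum in [S] and so cover [v], which lies on no
     edge of [S']. *)
  - move=> M MS' tM; have MS := subset_trans MS' S'S.
    have := matS M MS tM; rewrite leq_eqVlt => /orP[cM | //].
    have mM : matching_of_size S n.+1 M by exact/and3P.
    have /implyP/(_ mM)/coverP[e eM ve] := allv M.
    by have := subsetP MS' e eM; rewrite inE ve andbF.
  - move=> x; apply: leq_trans (degS x); apply/subset_leq_card/subsetP => e.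
    by rewrite !inE => /andP[/andP[-> _] ->].
move=> nov; apply: card_le_missable => // x.
have /negbT := nov x; rewrite negb_forall => /existsP[M].
by rewrite negb_imply => /andP[]; exists M.
Qed.

End MatchingNumber.

(** * From matchings in a strong clique to complete minors *)

Section StrongClique.

Variable G : sgraph.
Implicit Types (S M : {set {set G}}) (e : {set G}).

Lemma edgesP e :
  reflect (exists x y, adj x y /\ e = [set x; y]) (e \in edges G).
Proof.
apply: (iffP imsetP) => [[[x y]] | [x [y [xy ->]]]].
  by rewrite inE => xy ->; exists x, y.
by exists (x, y); rewrite ?inE.
Qed.

Lemma card_edge e : e \in edges G -> #|e| = 2.
Proof.
case/edgesP=> x [y [xy ->]]; rewrite cards2.
by case: eqVneq xy => // ->; rewrite adj_irrefl.
Qed.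

Lemma edge_degree_le S x : S \subset edges G -> edge_degree S x <= degree x.
Proof.
move=> /subsetP SE.
apply: leq_trans (leq_imset_card (fun y => [set x; y]) _).
apply/subset_leq_card/subsetP => e; rewrite inE => /andP[/SE /edgesP[a [b [ab ->]]]].
rewrite !inE => /orP[] /eqP->; apply/imsetP; first by exists b; rewrite ?inE.
by exists a; rewrite ?inE 1?adj_sym // setUC.
Qed.

Lemma edge_connected e : e \in edges G -> connected_set e.
Proof.
move=> eE; split; first by rewrite -card_gt0 card_edge.
case/edgesP: eE => a [b [ab ->]] x y.
rewrite !inE => /orP[] /eqP-> /orP[] /eqP->; rewrite ?connect0 //;
  by apply: connect1; rewrite /= !inE !eqxx ?orbT // adj_sym.
Qed.

Lemma strong_clique_matching_minor k S M :
  strong_clique S -> M \subset S -> trivIset M -> k <= #|M| ->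
  minor (complete_graph k) G.
Proof.
move=> /andP[/subsetP SE /forall_inP Sc] /subsetP MS tM kM.
pose phi (i : 'I_k) : {set G} := enum_val (widen_ord kM i).
have phiM i : phi i \in M by exact: enum_valP.
have dis i j : i != j -> [disjoint phi i & phi j].
  move=> nij; apply: (trivIsetP tM) => //.
  by apply: contra_neq nij => /enum_val_inj /(congr1 val) /= /val_inj.
exists phi; split=> // [i | i j nij]; first exact/edge_connected/SE/MS.
(* [strong_clique] constrains distinct edges only; equal disjoint edges would be empty. *)
have nphi : phi i != phi j.
  apply: contraTneq (dis i j nij) => ->.
  by rewrite -setI_eq0 setIid -card_gt0 card_edge //; exact/SE/MS.
have /forall_inP/(_ _ (MS _ (phiM j))) := Sc _ (MS _ (phiM i)).
rewrite nphi /= => /orP[/existsP[x /andP[xi xj]] | ].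
  by have /disjoint_setP/(_ x xi) := dis i j nij.
by case/exists_inP=> x xi /exists_inP[y yj xy]; exists x, y.
Qed.

End StrongClique.

(* For k = 0 the subtraction truncates, but then no graph is minor-free: the
   graph on no vertices is a minor of every graph. *)
Theorem theorem1p9 (k Delta : nat) (G : sgraph)
    (G_minor_free : minor_free (complete_graph k) G)
    (G_max_degree : max_degree G = Delta) :
  strong_clique_number G <= (k - 1) * (Delta + 1).
Proof.
apply/bigmax_leqP => S Sc; have /andP[SE _] := Sc.
rewrite addn1; apply: card_le_matching_degree.
- by move=> e /(subsetP SE); exact: card_edge.
- move=> M MS tM; have [kM | Mk] := leqP k #|M|.
    by case: G_minor_free; exact: (strong_clique_matching_minor Sc MS tM).
  (* [#|M| < k] forces [k] to be positive, so [k - 1] is not truncated. *)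
  by rewrite subn1 -ltnS (ltn_predK Mk).
- move=> x; apply: leq_trans (edge_degree_le x SE) _.
  by rewrite -G_max_degree; exact: (leq_bigmax x).
Qed.
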